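(* Let $\lambda\in\mathbb{K}$. (1) Let $(A,\circ_A,P,\omega)$ be a quadratic Rota-Baxter Zinbiel algebra of weight $\lambda$. Then $(A,\ast_A,P,\omega)$ is a Rota-Baxter commutative associative algebra with a nondegenerate Connes cocycle of weight $\lambda$, where $x\ast_A y=x\circ_A y+y\circ_A x$ for all $x,y\in A$. (2) Conversely, let $(A,\ast_A,P,\omega)$ be a Rota-Baxter commutative associative algebra with a nondegenerate Connes cocycle of weight $\lambda$. Then $(A,\circ_A,P,\omega)$ is a quadratic Rota-Baxter Zinbiel algebra of weight $\lambda$, where the multiplication $\circ_A$ is given by $\omega(x\circ_A y,z)=\omega(y,x\ast_A z)$ for all $x,y,z\in A$.
   Context: All vector spaces are finite-dimensional over a field $\mathbb{K}$. A Zinbiel algebra $(A,\circ_A)$ is a vector space with a bilinear product satisfying $x\circ_A(y\circ_A z)=(x\circ_A y+y\circ_A x)\circ_A z$. A quadratic Zinbiel algebra $(A,\circ_A,\omega)$ is a Zinbiel algebra with a nondegenerate skew-symmetric bilinear form $\omega\in\wedge^2A^*$ such that $\omega(x\circ_A y,z)=\omega(y,x\circ_A z+z\circ_A x)$ for all $x,y,z\in A$. A skew-symmetric bilinear form $\omega\in\wedge^2A^*$ is a Connes cocycle on a commutative associative algebra $(A,\ast_A)$ if $\omega(x\ast_A y,z)+\omega(y\ast_A z,x)+\omega(z\ast_A x,y)=0$ for all $x,y,z\in A$. A Rota-Baxter operator of weight $\lambda$ on an algebra $(A,\cdot)$ (a Zinbiel algebra or a commutative associative algebra) is a linear map $P:A\to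 A$ with $P(x)\cdot P(y)=P(P(x)\cdot y+x\cdot P(y)+\lambda x\cdot y)$ for all $x,y\in A$; $(A,\cdot,P)$ is then called a Rota-Baxter Zinbiel (resp. commutative associative) algebra of weight $\lambda$. A quadratic Rota-Baxter Zinbiel algebra of weight $\lambda$ is a quadruple $(A,\circ_A,P,\omega)$ such that $(A,\circ_A,P)$ is a Rota-Baxter Zinbiel algebra of weight $\lambda$, $(A,\circ_A,\omega)$ is a quadratic Zinbiel algebra, and $\omega(Px,y)+\omega(x,Py)+\lambda\omega(x,y)=0$ for all $x,y\in A$. A Rota-Baxter commutative associative algebra with a nondegenerate Connes cocycle of weight $\lambda$ is a quadruple $(A,\ast_A,P,\omega)$ such that $(A,\ast_A,P)$ is a Rota-Baxter commutative associative algebra of weight $\lambda$, $\omega$ is a nondegenerate Connes cocycle on $(A,\ast_A)$, and $\omega(Px,y)+\omega(x,Py)+\lambda\omega(x,y)=0$ for all $x,y\in A$. *)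

(* Defs.v *)
From HB Require Import structures.
From mathcomp Require Import all_boot all_order all_algebra.

Set Implicit Arguments.
Unset Strict Implicit.
Unset Printing Implicit Defensive.

Import GRing.Theory.
Local Open Scope ring_scope.

(* Multiplications on A are plain functions A -> A -> A; their bilinearity is
   part of the algebra axioms below, so that it is a genuine conclusion for a
   multiplication that is constructed from other data. *)
Section Algebras.
Variables (K : fieldType) (A : vectType K).
Implicit Types (mul : A -> A -> A) (P : {linear A -> A}).
Implicit Types (omega : {skew_symmetric A}) (lambda : K).

Definition bilinear_mul mul : Prop := bilinear_for *:%R *:%R mul.

Record is_zinbiel mul : Prop := IsZinbiel {
  zinbiel_bilinear : bilinear_mul mul;
  zinbielP : forall x y z, mul x (mul y z) = mul (mul x y + mul y x) z
}.

Record is_quadratic_zinbiel mul omega : Prop := IsQuadraticZinbiel {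
  quadratic_is_zinbiel : is_zinbiel mul;
  quadratic_nondegenerate : nondegenerate omega;
  quadratic_invariant :
    forall x y z, omega (mul x y) z = omega y (mul x z + mul z x)
}.

Record is_comm_assoc mul : Prop := IsCommAssoc {
  comm_assoc_bilinear : bilinear_mul mul;
  comm_assoc_comm : commutative mul;
  comm_assoc_assoc : associative mul
}.

Record is_connes_cocycle mul omega : Prop := IsConnesCocycle {
  connes_is_comm_assoc : is_comm_assoc mul;
  connes_cocycleP : forall x y z,
    omega (mul x y) z + omega (mul y z) x + omega (mul z x) y = 0
}.

Definition is_rota_baxter lambda mul P : Prop :=
  forall x y,
    mul (P x) (P y) = P (mul (P x) y + mul x (P y) + lambda *: mul x y).

Definition rota_baxter_compatible lambda P omega : Prop :=
  forall x y, omega (P x) y + omega x (P y) + lambda * omega x y = 0.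

Record is_rb_zinbiel lambda mul P : Prop := IsRBZinbiel {
  rb_zinbiel_is_zinbiel : is_zinbiel mul;
  rb_zinbiel_rota_baxter : is_rota_baxter lambda mul P
}.

Record is_rb_comm_assoc lambda mul P : Prop := IsRBCommAssoc {
  rb_comm_assoc_is_comm_assoc : is_comm_assoc mul;
  rb_comm_assoc_rota_baxter : is_rota_baxter lambda mul P
}.

Record is_quadratic_rb_zinbiel lambda mul P omega : Prop :=
  IsQuadraticRBZinbiel {
  quadratic_rb_is_rb_zinbiel : is_rb_zinbiel lambda mul P;
  quadratic_rb_is_quadratic : is_quadratic_zinbiel mul omega;
  quadratic_rb_compatible : rota_baxter_compatible lambda P omega
}.

Record is_rb_comm_assoc_connes lambda mul P omega : Prop :=
  IsRBCommAssocConnes {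
  rb_connes_is_rb_comm_assoc : is_rb_comm_assoc lambda mul P;
  rb_connes_nondegenerate : nondegenerate omega;
  rb_connes_is_cocycle : is_connes_cocycle mul omega;
  rb_connes_compatible : rota_baxter_compatible lambda P omega
}.

End Algebras.

(* Main.v *)
(* By nondegeneracy and [omega (P x) y = omega x (- P y - lambda y)], every
   identity between products becomes, after pairing with an arbitrary vector,
   an identity for [omega] and the commutative product alone.  In (2) the
   product [circ x y] is the vector representing [z |-> omega y (star x z)],
   and the cocycle condition says exactly that its symmetrization is [star]. *)
Require Import Defs.
From HB Require Import structures.
From mathcomp Require Import all_boot all_order all_algebra.
From mathcomp Require Import ring.

Set Implicit Arguments.
Unset Strict Implicit.
Unset Printing Implicit Defensive.

Import GRing.Theory.
Local Open Scope ring_scope.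

Section SkewForm.
Variables (K : fieldType) (A : vectType K) (omega : {skew_symmetric A}).

Lemma skewC x y : omega x y = - omega y x.
Proof. by rewrite hermC expr1 mulN1r. Qed.

Lemma rota_baxter_adjoint (lambda : K) (P : {linear A -> A}) :
  rota_baxter_compatible lambda P omega ->
  forall x y, omega (P x) y = omega x (- P y - lambda *: y).
Proof.
move=> compP x y; rewrite linearBr linearNr linearZr /=.
by apply/subr0_eq; rewrite -[RHS](compP x y); ring.
Qed.

Definition form_dual x : 'Hom(A, K^o) := linfun (omega x : A -> K^o).

Fact form_dual_is_linear : linear form_dual.
Proof.
move=> a x y; apply/lfunP => z.
by rewrite add_lfunE scale_lfunE !lfunE /= linearDl linearZl.
Qed.

HB.instance Definition _ :=
  GRing.isLinear.Build K A 'Hom(A, K^o) _ form_dual form_dual_is_linear.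

Lemma form_dualE x z : linfun form_dual x z = omega x z.
Proof. by rewrite lfunE /= /form_dual lfunE. Qed.

Hypothesis omega_nondeg : nondegenerate omega.

(** The difference [x - y] is orthogonal to all of [A], hence lies in the radical, which
    nondegeneracy makes zero. *)
Lemma nondegenerate_inj x y : (forall z, omega x z = omega y z) -> x = y.
Proof.
move=> eq_xy; apply/subr0_eq/eqP; rewrite -memv0 -(eqP omega_nondeg).
by apply/mem_orthovP => z _; rewrite linearBl /= eq_xy subrr.
Qed.

(** Nondegeneracy makes the map from [A] to its dual injective, and both spaces have the same finite
    dimension. *)
Lemma limg_form_dual : limg (linfun form_dual) = fullv.
Proof.
have /eqP ker0 : lker (linfun form_dual) == 0%VS.
  apply/lker0P => x y /lfunP eq_xy; apply: nondegenerate_inj => z.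
  by rewrite -!form_dualE eq_xy.
apply/eqP; rewrite eqEdim subvf limg_dim_eq ?ker0 ?capv0 //.
by rewrite !dimvf /dim /= muln1.
Qed.

(* Junk unless [g] is linear, since [linfun] is. *)
Definition form_repr (g : A -> K^o) : A :=
  ((linfun form_dual)^-1)%VF (linfun g).

Lemma form_reprP (g : {linear A -> K^o}) z : omega (form_repr g) z = g z.
Proof.
by rewrite -form_dualE limg_lfunVK ?limg_form_dual ?memvf // lfunE.
Qed.

End SkewForm.

Section ZinbielToCommutative.
Variables (K : fieldType) (A : vectType K) (circ : A -> A -> A).
Local Notation star := (fun x y => circ x y + circ y x).

Lemma zinbiel_comm_assoc : is_zinbiel circ -> is_comm_assoc star.
Proof.
case=> [[linl linr] zinb].
have addr x y z : circ x (y + z) = circ x y + circ x z.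
  by have := linr x 1 y z; rewrite /= !scale1r.
split=> [|x y|x y z] /=.
- by split=> u a x y /=; rewrite linl linr scalerDr addrACA.
- exact: addrC.
(* Both bracketings expand to the sum of [circ (star x y) z], [circ (star x z) y] and
   [circ (star y z) x]. *)
- by rewrite !addr !zinb addrA (addrC (circ z x)) (addrC (circ z y)).
Qed.

Lemma rota_baxter_symmetrize (lambda : K) (P : {linear A -> A}) :
  is_rota_baxter lambda circ P -> is_rota_baxter lambda star P.
Proof.
move=> rbP x y; rewrite !rbP -raddfD scalerDr; congr (P _).
(* Exchanging [x] and [y] swaps the roles of the first two Rota-Baxter terms, so each is paired with
   the other's mirror image. *)
by rewrite (AC (3*3) ((1*5)*(2*4)*(3*6))).
Qed.

Lemma quadratic_zinbiel_connes (omega : {skew_symmetric A}) :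
  is_quadratic_zinbiel circ omega -> is_connes_cocycle star omega.
Proof.
case=> zinb _ inv; split=> [|x y z]; first exact: zinbiel_comm_assoc.
(* Only [star x y] is expanded: invariance turns it into [omega y (star x z) + omega x (star y z)],
   which skew-symmetry cancels against the other two cocycle terms. *)
rewrite linearDl /= !inv (skewC _ y) (skewC _ x) (addrC (circ z x)).
ring.
Qed.

End ZinbielToCommutative.

Section CommutativeToZinbiel.
Variables (K : fieldType) (A : vectType K) (star : A -> A -> A).
Variable omega : {skew_symmetric A}.

Definition cocycle_mul (x y : A) : A :=
  form_repr omega (fun z => omega y (star x z)).

Lemma cocycle_mulE : nondegenerate omega -> bilinear_mul star ->
  forall x y z, omega (cocycle_mul x y) z = omega y (star x z).
Proof.
move=> nondeg [_ linr] x y z.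
have lin_g : linear (fun z => omega y (star x z) : K^o).
  by move=> a u v; rewrite linr linearDr linearZr.
pose g : {linear A -> K^o} := HB.pack (fun z => omega y (star x z) : K^o)
  (GRing.isLinear.Build K A K^o _ _ lin_g).
exact: (form_reprP nondeg g).
Qed.

(** From here on only the defining identity [circE] is used, not the construction through
    [form_repr]. *)
Variable circ : A -> A -> A.
Hypothesis nondeg : nondegenerate omega.
Hypothesis circE : forall x y z, omega (circ x y) z = omega y (star x z).

Lemma cocycle_mul_bilinear : bilinear_mul star -> bilinear_mul circ.
Proof.
case=> linl linr; split=> u a x y; apply: (nondegenerate_inj nondeg) => z.
  by rewrite linearDl linearZl /= !circE linl linearDr linearZr.
by rewrite linearDl linearZl /= !circE linearDl linearZl.
Qed.

Lemma cocycle_mul_symmetrize : is_connes_cocycle star omega ->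
  forall x y, circ x y + circ y x = star x y.
Proof.
case=> [[_ starC _] cocyc] x y; apply: (nondegenerate_inj nondeg) => z.
rewrite linearDl /= !circE (skewC _ y) (skewC _ x) (starC x z).
(* The difference of the two sides is the opposite of the cyclic sum at [x], [y], [z]. *)
by apply/subr0_eq; rewrite -[RHS]oppr0 -[in RHS](cocyc x y z); ring.
Qed.

(** Left [circ]-multiplication by [x] is adjoint to [star x]. The Zinbiel identity thus becomes
    [star y (star x w) = star (star x y) w], and invariance is [circE] itself once [star] is the
    symmetrization. *)
Lemma cocycle_mul_quadratic_zinbiel :
  is_connes_cocycle star omega -> is_quadratic_zinbiel circ omega.
Proof.
move=> conn; have sym := cocycle_mul_symmetrize conn.
case: (conn) => [[bil starC starA] _].
split=> // [|x y z]; last by rewrite sym circE.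
split=> [|x y z]; first exact: cocycle_mul_bilinear.
apply: (nondegenerate_inj nondeg) => w.
by rewrite sym !circE starA (starC y x).
Qed.

(** With Q = -P - lambda the adjoint of [P], moving everything off [y] leaves Q(Px * z) = Px * Qz +
    Q(x * Qz) + lambda (x * Qz), where * is [star]. *)
Lemma cocycle_mul_rota_baxter (lambda : K) (P : {linear A -> A}) :
  bilinear_mul star -> rota_baxter_compatible lambda P omega ->
  is_rota_baxter lambda star P -> is_rota_baxter lambda circ P.
Proof.
move=> [_ linr] compP rbP x y; apply: (nondegenerate_inj nondeg) => z.
have adj := rota_baxter_adjoint compP.
have starB u v w : star u (- v - lambda *: w) = - star u v - lambda *: star u w.
  rewrite (zmod_morphism_linear (linr u)) (scalable_linear (linr u)).
  by rewrite -scaleN1r (scalable_linear (linr u)) /= scaleN1r.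
rewrite adj !linearDl linearZl /= !circE !adj -!linearZr /= -!linearDr /=.
(* Since Q + lambda = -P, the last two terms merge into -P(x * Qz); the rest is the Rota-Baxter
   identity of [star] at [x] and [z]. *)
congr (omega y _); rewrite -addrA subrK !starB rbP addrAC -!opprD.
by congr (- (_ + _)); rewrite -raddfD -[_ + _ + lambda *: _]addrA addrK.
Qed.

End CommutativeToZinbiel.

Theorem theorem5p4 (K : fieldType) (A : vectType K) (lambda : K) :
  (forall (circ : A -> A -> A) (P : {linear A -> A})
          (omega : {skew_symmetric A}),
     is_quadratic_rb_zinbiel lambda circ P omega ->
     is_rb_comm_assoc_connes lambda (fun x y => circ x y + circ y x) P omega)
  /\
  (forall (star : A -> A -> A) (P : {linear A -> A})
          (omega : {skew_symmetric A}),
     is_rb_comm_assoc_connes lambda star P omega ->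
     exists circ : A -> A -> A,
       [/\ forall x y z, omega (circ x y) z = omega y (star x z),
           forall circ' : A -> A -> A,
             (forall x y z, omega (circ' x y) z = omega y (star x z)) ->
             forall x y, circ' x y = circ x y
         & is_quadratic_rb_zinbiel lambda circ P omega]).
Proof.
split=> [circ P omega [[zinb rbP] quad compP] | star P omega].
  split=> //; last exact: quadratic_zinbiel_connes.
  - by split; [exact: zinbiel_comm_assoc | exact: rota_baxter_symmetrize].
  - exact: quadratic_nondegenerate quad.
case=> [[[bil _ _] rbP] nondeg conn compP].
have circE := cocycle_mulE nondeg bil.
have quad := cocycle_mul_quadratic_zinbiel nondeg circE conn.
exists (cocycle_mul star omega); split=> // [circ' circ'E x y|].
  by apply: (nondegenerate_inj nondeg) => z; rewrite circ'E circE.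
split=> //; split; first exact: quadratic_is_zinbiel quad.
exact: (cocycle_mul_rota_baxter nondeg circE bil compP rbP).
Qed.
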